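(* Consider the quantized compressive sensing setting of the context: $\tilde\Phi\in\mathbb{R}^{\tilde M\times N}$, $\tilde y\in\mathbb{R}^{\tilde M}$, $\Delta>0$, $\lambda>0$, a true signal $x^*\in\mathbb{R}^N$ that is feasible for problem (P), a minimizer $\hat x$ of (P), and $h=\hat x-x^*$. Let $s\in\{1,2,\dots,N\}$ and, for a matrix $\Psi$ with $N$ columns, define \[ \bar A_0(\Psi):=\rho^-(2s,\Psi)-3[\rho^+(3s,\Psi)-\rho^-(3s,\Psi)],\qquad \bar A_1(\Psi):=4[\rho^+(3s,\Psi)-\rho^-(3s,\Psi)], \] \[ \bar C_1(\Psi):=4+\sqrt{10}\,\bar A_1(\Psi)/\bar A_0(\Psi),\qquad \bar C_2(\Psi):=\sqrt{10/\bar A_0(\Psi)} . \] (1) Assume that $\|\tilde\Phi^T(\tilde\Phi x^*-\tilde y)\|_\infty\le\lambda\Delta/2$. Then for any $T_0\subset\{1,\dots,N\}$ with $|T_0|=s$, if $\bar A_0(\tilde\Phi)>0$, then \[ \|h\|\le 2\bar C_2(\tilde\Phi)^2\sqrt{s}\,\lambda\Delta+\frac{\bar C_1(\tilde\Phi)}{\sqrt s}\|x^*_{T_0^c}\|_1+2.5\,\bar C_2(\tilde\Phi)\sqrt{\lambda\Delta\|x^*_{T_0^c}\|_1}, \qquad (a) \] \[ \|h\|\le \bar C_2(\tilde\Phi)\sqrt{\tilde M}\,\Delta+\frac{\bar C_1(\tilde\Phi)}{\sqrt s}\|x^*_{T_0^c}\|_1. \qquad (b) \] (2) Suppose instead that the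 quantization errors $(\tilde\Phi x^*-\tilde y)_i$, $i=1,\dots,\tilde M$, are independent random variables with expectation $0$ (and bounded in absolute value by $\Delta/2$), that $\bar A_0(\tilde\Phi)>0$, and let $\pi\in(0,1)$. If $\lambda=\sqrt{2\log(2N/\pi)}\,f_{\max}$ in (P), then with probability at least $1-\pi$ the inequalities (a) and (b) hold (for any $T_0\subset\{1,\dots,N\}$ with $|T_0|=s$).
   Context: Setting. A quantization interval $\Delta>0$ and number of bits $B$ are given, and $G:=2^{B-1}\Delta$. The sensing matrix is split by rows into an unsaturated part $\tilde\Phi\in\mathbb{R}^{\tilde M\times N}$ and saturated parts $\bar\Phi_+,\bar\Phi_-$ (each with $N$ columns). $\tilde y\in\mathbb{R}^{\tilde M}$ is the vector of recorded (quantized) unsaturated measurements. Problem (P), with parameter $\lambda>0$, is \[ \min_{x\in\mathbb{R}^N}\ \tfrac12\|\tilde\Phi x-\tilde y\|^2+\lambda\Delta\|x\|_1\quad\text{s.t.}\quad \|\tilde\Phi x-\tilde y\|_\infty\le\Delta/2,\ \ \bar\Phi_+x\ge(G-\Delta)\mathbf 1,\ \ \bar\Phi_-x\le(\Delta-G)\mathbf 1, \] where $\mathbf 1$ is the all-ones vector and vector inequalities are componentwise. The true signal $x^*\in\mathbb{R}^N$ is assumed feasible for (P); $\hat x$ is a solution (global minimizer) of (P) and $h:=\hat x-x^*$. In part (2), $x^*$, the matrices $\tilde\Phi,\bar\Phi_\pm$ and the numbers $\Delta, G$ are fixed, and the only randomness is in the quantization errors $\tilde\Phi x^*-\tilde y$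 (equivalently in $\tilde y$). Notation. $\|\cdot\|$ is the $\ell_2$ norm and $\|\cdot\|_p$ the $\ell_p$ norm. For $z\in\mathbb{R}^N$ and $T\subset\{1,\dots,N\}$, $z_T$ is the subvector indexed by $T$, $T^c$ is the complement of $T$ in $\{1,\dots,N\}$, and $\Psi_T$ is the submatrix of the columns of $\Psi$ indexed by $T$. $f_{\max}:=\max_{i}\|\tilde\Phi_i\|$, where $\tilde\Phi_i$ is the $i$th column of $\tilde\Phi$. For a matrix $\Psi$ with $N$ columns and integer $k\ge1$, \[ \rho^-(k,\Psi):=\min_{|T|\le k,\ h_T\neq0}\frac{\|\Psi_Th_T\|^2}{\|h_T\|^2},\qquad \rho^+(k,\Psi):=\max_{|T|\le k,\ h_T\neq 0}\frac{\|\Psi_Th_T\|^2}{\|h_T\|^2}, \] over $T\subset\{1,\dots,N\}$ and $h\in\mathbb{R}^N$. *)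

(* Defs.v *)
From HB Require Import structures.
From mathcomp Require Import all_boot all_order all_algebra.
From mathcomp Require Import all_classical all_reals all_analysis.
Set Implicit Arguments.
Unset Strict Implicit.
Unset Printing Implicit Defensive.
Import Order.TTheory GRing.Theory Num.Theory.
Import numFieldNormedType.Exports.
Local Open Scope classical_set_scope.
Local Open Scope ring_scope.

(* The l_oo norm of a vector v is the library's norm `|v| on matrices, which
   is the maximum of the absolute values of the entries. *)
Definition norm2 (R : realType) (n : nat) (v : 'cV[R]_n) : R :=
  Num.sqrt (\sum_(i < n) v i ord0 ^+ 2).

Definition norm1 (R : realType) (n : nat) (v : 'cV[R]_n) : R :=
  \sum_(i < n) `|v i ord0|.

Definition subvec (R : realType) (N : nat) (T : {set 'I_N}) (z : 'cV[R]_N) :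
    'cV[R]_#|T| :=
  rowsub (fun i : 'I_#|T| => enum_val i) z.

Definition subcols (R : realType) (M N : nat) (T : {set 'I_N})
    (Psi : 'M[R]_(M, N)) : 'M[R]_(M, #|T|) :=
  colsub (fun i : 'I_#|T| => enum_val i) Psi.

Definition rayleigh_values (R : realType) (M N : nat) (k : nat)
    (Psi : 'M[R]_(M, N)) : set R :=
  [set r | exists (T : {set 'I_N}) (h : 'cV[R]_N),
     [/\ (#|T| <= k)%N, subvec T h != 0
       & r = norm2 (subcols T Psi *m subvec T h) ^+ 2
             / norm2 (subvec T h) ^+ 2]].

(* For 1 <= k and 1 <= N this set is nonempty and bounded, and it is a finite
   union of continuous images of unit spheres, so that inf and sup are its
   minimum and maximum. *)
Definition rho_minus (R : realType) (M N : nat) (k : nat)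
    (Psi : 'M[R]_(M, N)) : R := inf (rayleigh_values k Psi).

Definition rho_plus (R : realType) (M N : nat) (k : nat)
    (Psi : 'M[R]_(M, N)) : R := sup (rayleigh_values k Psi).

Definition A0bar (R : realType) (M N : nat) (s : nat) (Psi : 'M[R]_(M, N)) : R :=
  rho_minus (2 * s) Psi - 3 * (rho_plus (3 * s) Psi - rho_minus (3 * s) Psi).

Definition A1bar (R : realType) (M N : nat) (s : nat) (Psi : 'M[R]_(M, N)) : R :=
  4 * (rho_plus (3 * s) Psi - rho_minus (3 * s) Psi).

Definition C1bar (R : realType) (M N : nat) (s : nat) (Psi : 'M[R]_(M, N)) : R :=
  4 + Num.sqrt 10 * A1bar s Psi / A0bar s Psi.

Definition C2bar (R : realType) (M N : nat) (s : nat) (Psi : 'M[R]_(M, N)) : R :=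
  Num.sqrt (10 / A0bar s Psi).

Definition fmax (R : realType) (M N : nat) (Phi : 'M[R]_(M, N)) : R :=
  \big[Num.max/0]_(i < N) norm2 (col i Phi).

Definition saturation_level (R : realType) (B : nat) (Delta : R) : R :=
  2 ^+ (B - 1) * Delta.

Definition objective (R : realType) (M N : nat) (Phi : 'M[R]_(M, N))
    (y : 'cV[R]_M) (lambda Delta : R) (x : 'cV[R]_N) : R :=
  2^-1 * norm2 (Phi *m x - y) ^+ 2 + lambda * Delta * norm1 x.

Definition feasible (R : realType) (M Mp Mm N : nat) (Phi : 'M[R]_(M, N))
    (Phip : 'M[R]_(Mp, N)) (Phim : 'M[R]_(Mm, N)) (y : 'cV[R]_M)
    (Delta G : R) (x : 'cV[R]_N) : Prop :=
  [/\ `|Phi *m x - y| <= Delta / 2,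
      forall i : 'I_Mp, G - Delta <= (Phip *m x) i ord0
    & forall i : 'I_Mm, (Phim *m x) i ord0 <= Delta - G].

Definition is_solution (R : realType) (M Mp Mm N : nat) (Phi : 'M[R]_(M, N))
    (Phip : 'M[R]_(Mp, N)) (Phim : 'M[R]_(Mm, N)) (y : 'cV[R]_M)
    (lambda Delta G : R) (x : 'cV[R]_N) : Prop :=
  feasible Phi Phip Phim y Delta G x /\
  forall z : 'cV[R]_N, feasible Phi Phip Phim y Delta G z ->
    objective Phi y lambda Delta x <= objective Phi y lambda Delta z.

Definition bound_a (R : realType) (M N : nat) (Phi : 'M[R]_(M, N))
    (lambda Delta : R) (s : nat) (xstar h : 'cV[R]_N) (T0 : {set 'I_N}) : Prop :=
  norm2 h <= 2 * C2bar s Phi ^+ 2 * Num.sqrt s%:R * lambda * Delta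
             + C1bar s Phi / Num.sqrt s%:R * norm1 (subvec (~: T0) xstar)
             + 5 / 2 * C2bar s Phi
               * Num.sqrt (lambda * Delta * norm1 (subvec (~: T0) xstar)).

Definition bound_b (R : realType) (M N : nat) (Phi : 'M[R]_(M, N))
    (Delta : R) (s : nat) (xstar h : 'cV[R]_N) (T0 : {set 'I_N}) : Prop :=
  norm2 h <= C2bar s Phi * Num.sqrt M%:R * Delta
             + C1bar s Phi / Num.sqrt s%:R * norm1 (subvec (~: T0) xstar).

Definition mutually_independent (d : measure_display) (T : measurableType d)
    (R : realType) (P : probability T R) (I : finType)
    (X : I -> {RV P >-> R}) : Prop :=
  forall (J : {set I}) (B : I -> set R),
    (forall i, measurable (B i)) ->
    P (\bigcap_(i in [set` J]) (X i @^-1` B i)) =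
    (\prod_(i in J) P (X i @^-1` B i))%E.

(* Main.v *)
(* Optimality of xhat together with the bound on Phi^T e, e = Phi xstar - y,
   puts h = xhat - xstar in the cone
   |h_{T0^c}|_1 <= 3 |h_{T0}|_1 + 4 sigma, where sigma = |xstar_{T0^c}|_1, and
   bounds |Phi h|^2 by lambda Delta (3 |h_{T0}|_1 + 4 sigma); feasibility bounds
   it by M Delta^2.  Let T1 be the s largest entries of h outside T0, and
   a = |h_{T0 u T1}|.  Cutting the remaining entries into decreasing blocks of
   size s, the norms of the blocks sum to at most
   |h_{T0^c}|_1 / sqrt s <= 3 a + 4 sigma / sqrt s.  The parallelogram identity
   controls the cross terms of |Phi h|^2, so that
   |Phi h|^2 >= A0 a^2 - A1 a sigma / sqrt s.  Solving the two quadratic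
   inequalities for a, and using |h| <= sqrt 10 a + 4 sigma / sqrt s, gives (a)
   and (b).

   For random errors, Hoeffding's inequality applied to the two signs of each
   of the N correlations, and a union bound, give the bound on Phi^T e with
   probability at least 1 - p. *)
Require Import Defs.
From HB Require Import structures.
From mathcomp Require Import all_boot all_order all_algebra.
From mathcomp Require Import all_classical all_reals all_analysis.
From mathcomp Require Import measurable_realfun.
From mathcomp Require Import ring lra.
Set Implicit Arguments.
Unset Strict Implicit.
Unset Printing Implicit Defensive.
Import Order.TTheory GRing.Theory Num.Theory.
Import numFieldNormedType.Exports.
Local Open Scope ring_scope.

(** Cauchy-Schwarz without square roots: the sum of the squares [(B * a i - C * b i) ^+ 2] equals
    [B * (A * B - C ^+ 2)]. If [B] vanishes, so does every [b i]. *)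
Lemma sqr_sum_le (R : realFieldType) (I : finType) (P : pred I) (a b : I -> R) :
  (\sum_(i | P i) a i * b i) ^+ 2 <=
  (\sum_(i | P i) a i ^+ 2) * (\sum_(i | P i) b i ^+ 2).
Proof.
set A := \sum_(i | P i) a i ^+ 2; set B := \sum_(i | P i) b i ^+ 2.
set C := \sum_(i | P i) a i * b i.
have B0 : 0 <= B by apply: sumr_ge0 => i _; exact: sqr_ge0.
have : 0 <= \sum_(i | P i) (B * a i - C * b i) ^+ 2.
  by apply: sumr_ge0 => i _; exact: sqr_ge0.
have -> : \sum_(i | P i) (B * a i - C * b i) ^+ 2 = B * (A * B - C ^+ 2).
  transitivity (\sum_(i | P i) B ^+ 2 * a i ^+ 2
      - \sum_(i | P i) 2 * B * C * (a i * b i) + \sum_(i | P i) C ^+ 2 * b i ^+ 2).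
    by rewrite -sumrB -big_split /=; apply: eq_bigr => i _; ring.
  by rewrite -!mulr_sumr -/A -/B -/C; ring.
have [B_gt0|B_le0] := ltP 0 B; first by rewrite pmulr_rge0// subr_ge0.
have BE : B = 0 by apply/eqP; rewrite eq_le B_le0.
suff -> : C = 0 by rewrite expr0n/= BE mulr0.
have /psumr_eq0P b0 := BE.
by apply: big1 => i Pi; have /eqP := b0 (fun i _ => sqr_ge0 _) i Pi;
  rewrite sqrf_eq0 => /eqP->; rewrite mulr0.
Qed.

(** * Euclidean vectors and their restrictions to index sets *)

Section vectors.
Variable R : realType.

Definition dotv n (u v : 'cV[R]_n) : R := \sum_i u i ord0 * v i ord0.

(** Zero padding keeps the ambient dimension, so that restrictions to different index sets can be
    added. It stands in for [subvec], with the same norm and the same image under the matrix. *)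
Definition mask n (T : {set 'I_n}) (z : 'cV[R]_n) : 'cV[R]_n :=
  \col_i (if i \in T then z i ord0 else 0).

Lemma norm2_ge0 n (v : 'cV[R]_n) : 0 <= norm2 v.
Proof. exact: sqrtr_ge0. Qed.

Lemma norm2_sqr n (v : 'cV[R]_n) : norm2 v ^+ 2 = \sum_i v i ord0 ^+ 2.
Proof. by rewrite sqr_sqrtr// sumr_ge0// => i _; exact: sqr_ge0. Qed.

Lemma norm2_eq0 n (v : 'cV[R]_n) : (norm2 v == 0) = (v == 0).
Proof.
rewrite -sqrf_eq0 norm2_sqr; apply/eqP/eqP => [|->]; last first.
  by apply: big1 => i _; rewrite mxE expr0n.
move/psumr_eq0P => h; apply/colP => i; rewrite mxE.
by have /eqP := h (fun i _ => sqr_ge0 _) i isT; rewrite sqrf_eq0 => /eqP.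
Qed.

Lemma dotvDl n (u v w : 'cV[R]_n) : dotv (u + v) w = dotv u w + dotv v w.
Proof. by rewrite /dotv -big_split; apply: eq_bigr => i _; rewrite mxE mulrDl. Qed.

Lemma dotvC n (u v : 'cV[R]_n) : dotv u v = dotv v u.
Proof. by apply: eq_bigr => i _; rewrite mulrC. Qed.

Lemma dotvDr n (u v w : 'cV[R]_n) : dotv u (v + w) = dotv u v + dotv u w.
Proof. by rewrite dotvC dotvDl !(dotvC u). Qed.

Lemma dotvZl n a (u v : 'cV[R]_n) : dotv (a *: u) v = a * dotv u v.
Proof. by rewrite /dotv mulr_sumr; apply: eq_bigr => i _; rewrite mxE mulrA. Qed.

Lemma dotvZr n a (u v : 'cV[R]_n) : dotv u (a *: v) = a * dotv u v.
Proof. by rewrite dotvC dotvZl dotvC. Qed.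

Lemma dotv0 n (u : 'cV[R]_n) : dotv u 0 = 0.
Proof. by apply: big1 => i _; rewrite mxE mulr0. Qed.

Lemma dotvv n (u : 'cV[R]_n) : dotv u u = norm2 u ^+ 2.
Proof. by rewrite norm2_sqr; apply: eq_bigr => i _; rewrite expr2. Qed.

Lemma norm2D_sqr n (u v : 'cV[R]_n) :
  norm2 (u + v) ^+ 2 = norm2 u ^+ 2 + 2 * dotv u v + norm2 v ^+ 2.
Proof. by rewrite -!dotvv !(dotvDl, dotvDr) (dotvC v u); ring. Qed.

Lemma dotv_mulmx m n (Phi : 'M[R]_(m, n)) u v :
  dotv (Phi *m u) v = dotv u (Phi^T *m v).
Proof.
rewrite /dotv; under eq_bigr do rewrite mxE mulr_suml.
rewrite exchange_big; apply: eq_bigr => j _ /=.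
by rewrite mxE mulr_sumr; apply: eq_bigr => i _; rewrite mxE; ring.
Qed.

Lemma norm2_mask_sqr n (T : {set 'I_n}) (z : 'cV[R]_n) :
  norm2 (mask T z) ^+ 2 = \sum_(i in T) z i ord0 ^+ 2.
Proof.
rewrite norm2_sqr [RHS]big_mkcond; apply: eq_bigr => i _.
by rewrite mxE; case: ifP; rewrite ?expr0n.
Qed.

Lemma norm2_subvec n (T : {set 'I_n}) (z : 'cV[R]_n) :
  norm2 (subvec T z) = norm2 (mask T z).
Proof.
apply/eqP; rewrite -(eqrXn2 (n := 2))// ?norm2_ge0// norm2_mask_sqr norm2_sqr.
by apply/eqP; rewrite [RHS]big_enum_val; apply: eq_bigr => i _; rewrite mxE.
Qed.

Lemma norm1_subvec n (T : {set 'I_n}) (z : 'cV[R]_n) :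
  norm1 (subvec T z) = \sum_(i in T) `|z i ord0|.
Proof. by rewrite [RHS]big_enum_val; apply: eq_bigr => i _; rewrite mxE. Qed.

Lemma subcols_mul_subvec m n (T : {set 'I_n}) (Phi : 'M[R]_(m, n)) z :
  subcols T Phi *m subvec T z = Phi *m mask T z.
Proof.
apply/colP => i; rewrite !mxE [RHS](bigID (mem T)) /= [X in _ + X]big1 ?addr0.
  rewrite [RHS]big_enum_val; apply: eq_bigr => j _; rewrite !mxE.
  by rewrite enum_valP.
by move=> j /negbTE jT; rewrite mxE jT mulr0.
Qed.

Lemma mask0 n (z : 'cV[R]_n) : mask finset.set0 z = 0.
Proof. by apply/colP => i; rewrite !mxE inE. Qed.

Lemma maskT n (z : 'cV[R]_n) : mask finset.setT z = z.
Proof. by apply/colP => i; rewrite !mxE inE. Qed.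

Lemma maskU n (A B : {set 'I_n}) (z : 'cV[R]_n) :
  [disjoint A & B] -> mask (A :|: B) z = mask A z + mask B z.
Proof.
move=> AB; apply/colP => i; rewrite !mxE inE.
have [iA|] := boolP (i \in A); last by rewrite add0r.
by rewrite (disjointFr AB iA) addr0.
Qed.

Lemma dotv_mask n (A B : {set 'I_n}) (z : 'cV[R]_n) :
  [disjoint A & B] -> dotv (mask A z) (mask B z) = 0.
Proof.
move=> AB; apply: big1 => i _; rewrite !mxE.
have [iA|] := boolP (i \in A); last by rewrite mul0r.
by rewrite (disjointFr AB iA) mulr0.
Qed.

(** * Restricted extreme eigenvalues *)

(** Cauchy-Schwarz on each row. This Frobenius bound makes the Rayleigh quotients bounded above, so
    that their [sup] is an upper bound. *)
Lemma mulmx_norm2_le m n (Phi : 'M[R]_(m, n)) u :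
  norm2 (Phi *m u) ^+ 2 <= (\sum_i \sum_j Phi i j ^+ 2) * norm2 u ^+ 2.
Proof.
rewrite !norm2_sqr mulr_suml ler_sum// => i _.
rewrite mxE.
exact: (@sqr_sum_le R 'I_n predT (fun j => Phi i j) (fun j => u j ord0)).
Qed.

Lemma rayleigh_valuesP m n k (Phi : 'M[R]_(m, n)) (T : {set 'I_n}) (z : 'cV[R]_n) :
  (#|T| <= k)%N -> mask T z != 0 ->
  rayleigh_values k Phi (norm2 (Phi *m mask T z) ^+ 2 / norm2 (mask T z) ^+ 2).
Proof.
move=> Tk z0; exists T, z; split => //.
  by rewrite -norm2_eq0 norm2_subvec norm2_eq0.
by rewrite subcols_mul_subvec norm2_subvec.
Qed.

Lemma rho_minus_le m n k (Phi : 'M[R]_(m, n)) (T : {set 'I_n}) (z : 'cV[R]_n) :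
  (#|T| <= k)%N ->
  rho_minus k Phi * norm2 (mask T z) ^+ 2 <= norm2 (Phi *m mask T z) ^+ 2.
Proof.
move=> Tk; have [->|z0] := eqVneq (mask T z) 0.
  have /eqP -> : norm2 (0 : 'cV[R]_n) == 0 by rewrite norm2_eq0.
  by rewrite expr0n/= mulr0 sqr_ge0.
rewrite -ler_pdivlMr; last by rewrite exprn_gt0// lt_neqAle norm2_ge0 eq_sym norm2_eq0 z0.
apply: ge_inf; last exact: rayleigh_valuesP.
by exists 0 => _ [S [x [_ _ ->]]]; rewrite divr_ge0// sqr_ge0.
Qed.

Lemma le_rho_plus m n k (Phi : 'M[R]_(m, n)) (T : {set 'I_n}) (z : 'cV[R]_n) :
  (#|T| <= k)%N ->
  norm2 (Phi *m mask T z) ^+ 2 <= rho_plus k Phi * norm2 (mask T z) ^+ 2.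
Proof.
move=> Tk; have [->|z0] := eqVneq (mask T z) 0.
  have n0 p : norm2 (0 : 'cV[R]_p) = 0 by apply/eqP; rewrite norm2_eq0.
  by rewrite mulmx0 !n0 expr0n/= mulr0.
rewrite -ler_pdivrMr; last by rewrite exprn_gt0// lt_neqAle norm2_ge0 eq_sym norm2_eq0 z0.
apply: ub_le_sup; last exact: rayleigh_valuesP.
exists (\sum_i \sum_j Phi i j ^+ 2) => _ [S [x [_ x0 ->]]].
rewrite subcols_mul_subvec norm2_subvec.
rewrite ler_pdivrMr ?mulmx_norm2_le// exprn_gt0//.
by rewrite lt_neqAle norm2_ge0 eq_sym -norm2_subvec norm2_eq0 x0.
Qed.

(** The quotient of a nonzero vector supported on one index lies between the two. *)
Lemma rho_minus_le_plus m n k (Phi : 'M[R]_(m, n)) :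
  (0 < n)%N -> (0 < k)%N -> rho_minus k Phi <= rho_plus k Phi.
Proof.
case: n Phi => // n Phi _ k0.
have T1 : (#|[set ord0 : 'I_n.+1]| <= k)%N by rewrite cards1.
pose z : 'cV[R]_n.+1 := const_mx 1.
rewrite -(ler_pM2r (x := norm2 (mask [set ord0] z) ^+ 2)).
  exact: (le_trans (rho_minus_le _ _ T1) (le_rho_plus _ _ T1)).
by rewrite norm2_mask_sqr big_set1 mxE expr1n.
Qed.

(* Parallelogram identity applied to [|v| u + |u| v] and [|v| u - |u| v], which
   have the same norm because [u] and [v] have disjoint supports. *)
Lemma dotv_mulmx_mask_ge m n k (Phi : 'M[R]_(m, n)) (A B : {set 'I_n}) z :
  [disjoint A & B] -> (#|A :|: B| <= k)%N ->
  - dotv (Phi *m mask A z) (Phi *m mask B z) <=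
  2^-1 * (rho_plus k Phi - rho_minus k Phi) * norm2 (mask A z)
    * norm2 (mask B z).
Proof.
move=> AB ABk; set p := norm2 (mask A z); set q := norm2 (mask B z).
have [pq0|pq_neq0] := eqVneq (p * q) 0.
  rewrite -mulrA pq0 mulr0; move/eqP: pq0; rewrite mulf_eq0 !norm2_eq0.
  by move=> /orP[] /eqP->; rewrite mulmx0 ?(dotvC 0) dotv0 oppr0.
have pq_gt0 : 0 < p * q by rewrite lt_neqAle eq_sym pq_neq0 mulr_ge0// norm2_ge0.
pose w (a b : R) : 'cV[R]_n := \col_i (if i \in A then a * z i ord0 else b * z i ord0).
have wE a b : mask (A :|: B) (w a b) = a *: mask A z + b *: mask B z.
  apply/colP => i; rewrite !mxE inE.
  have [iA|] := boolP (i \in A); first by rewrite (disjointFr AB iA) mulr0 addr0.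
  by rewrite mulr0 add0r /=; case: ifP; rewrite ?mulr0.
have nw a b : norm2 (mask (A :|: B) (w a b)) ^+ 2 = a ^+ 2 * p ^+ 2 + b ^+ 2 * q ^+ 2.
  by rewrite wE -[LHS]dotvv !(dotvDl, dotvDr, dotvZl, dotvZr) (dotvC (mask B z))
       (dotv_mask z AB) !dotvv -/p -/q; ring.
have nPw a b : norm2 (Phi *m mask (A :|: B) (w a b)) ^+ 2 =
    a ^+ 2 * norm2 (Phi *m mask A z) ^+ 2 + b ^+ 2 * norm2 (Phi *m mask B z) ^+ 2
    + 2 * a * b * dotv (Phi *m mask A z) (Phi *m mask B z).
  rewrite wE mulmxDr -!scalemxAr -[LHS]dotvv !(dotvDl, dotvDr, dotvZl, dotvZr).
  by rewrite !dotvv (dotvC (_ *m mask B z)); ring.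
have := rho_minus_le Phi (w q p) ABk; have := le_rho_plus Phi (w q (- p)) ABk.
rewrite !nw !nPw sqrrN => h1 h2.
rewrite -(ler_pM2l pq_gt0).
lra.
Qed.

(** * Decomposition into blocks of decreasing magnitude *)

(** Greedy choice: a maximal remaining index joins the set at each step. *)
Lemma top_subset n (z : 'I_n -> R) (S : {set 'I_n}) m : (m <= #|S|)%N ->
  exists T : {set 'I_n}, [/\ T \subset S, #|T| = m &
    forall i j, i \in T -> j \in S :\: T -> z j <= z i].
Proof.
elim: m => [_|m IH mS].
  by exists finset.set0; rewrite finset.sub0set cards0; split=> // i j; rewrite inE.
have [T [TS Tm Tz]] := IH (ltnW mS).
have /card_gt0P[i0 i0ST] : (0 < #|S :\: T|)%N.
  by rewrite cardsD (finset.setIidPr TS) subn_gt0 Tm.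
have [k kST kmax] := @arg_maxP _ _ _ i0 (mem (S :\: T)) z i0ST.
have /finset.setDP[kS kT] := kST.
exists (k |: T); split.
- by rewrite finset.subUset finset.sub1set kS.
- by rewrite cardsU1 kT Tm.
- move=> i j; rewrite !inE negb_or => iT /andP[/andP[jk jT] jS].
  have jST : j \in S :\: T by rewrite !inE jT.
  by move: iT => /orP[/eqP->|iT]; [exact: kmax|exact: Tz].
Qed.

(** Cauchy-Schwarz against the all-ones vector on [T]. *)
Lemma sum_abs_le n (T : {set 'I_n}) (z : 'cV[R]_n) s : (#|T| <= s)%N ->
  \sum_(i in T) `|z i ord0| <= Num.sqrt s%:R * norm2 (mask T z).
Proof.
move=> Ts; rewrite -(ler_pXn2r (n := 2))//; last 2 first.
- by rewrite nnegrE sumr_ge0.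
- by rewrite nnegrE mulr_ge0// ?sqrtr_ge0 ?norm2_ge0.
have := @sqr_sum_le R 'I_n [in T] (fun=> 1) (fun j => `|z j ord0|).
rewrite exprMn sqr_sqrtr// norm2_mask_sqr expr1n.
under eq_bigr do rewrite mul1r; under [in X in _ <= _ * X -> _]eq_bigr do rewrite real_normK ?num_real//.
move/le_trans; apply; rewrite ler_wpM2r ?sumr_ge0// => [i _|]; first exact: sqr_ge0.
by rewrite sumr_const ler_nat.
Qed.

Section blocks.
Variables (n s : nat) (z : 'cV[R]_n) (K : R) (g : {set 'I_n} -> R).
Hypothesis s_gt0 : (0 < s)%N.
Hypothesis K_ge0 : 0 <= K.
Hypothesis gU : forall A B : {set 'I_n}, [disjoint A & B] -> g (A :|: B) <= g A + g B.

Let sq_gt0 : 0 < Num.sqrt s%:R :> R.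
Proof. by rewrite sqrtr_gt0 ltr0n. Qed.

Let sqE : Num.sqrt s%:R = s%:R / Num.sqrt s%:R :> R.
Proof. by rewrite -[X in X / _]sqr_sqrtr// expr2 mulfK// gt_eqF. Qed.

(* Splitting off the [s] largest entries repeatedly, each block has norm at most
   [sqrt s] times the smallest entry of the previous block, which is at most the
   l1 norm of the previous block divided by [sqrt s]. *)
Lemma blocks_le (S : {set 'I_n}) c : 0 <= c ->
  (forall A : {set 'I_n}, A \subset S -> (#|A| <= s)%N -> g A <= K * norm2 (mask A z)) ->
  (forall i, i \in S -> `|z i ord0| <= c) ->
  g S <= K * (Num.sqrt s%:R * c + (\sum_(i in S) `|z i ord0|) / Num.sqrt s%:R).
Proof.
have normle (A : {set 'I_n}) c' : 0 <= c' -> (#|A| <= s)%N ->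
    (forall i, i \in A -> `|z i ord0| <= c') -> norm2 (mask A z) <= Num.sqrt s%:R * c'.
  move=> c0 As Ac; rewrite -(ler_pXn2r (n := 2))//; last 2 first.
  - by rewrite nnegrE norm2_ge0.
  - by rewrite nnegrE mulr_ge0// ltW.
  rewrite norm2_mask_sqr exprMn sqr_sqrtr//.
  apply: (@le_trans _ _ (\sum_(i in A) c' ^+ 2)).
    by apply: ler_sum => i iA; rewrite -real_normK ?num_real// lerXn2r ?nnegrE// Ac.
  by rewrite sumr_const -[leLHS]mulr_natl ler_wpM2r ?sqr_ge0// ler_nat.
(* Strong induction on the size of [S]; the bound [c] varies, because the smallest entry of the
   removed block becomes the bound for the rest. *)
have [k] := ubnP #|S|; elim: k S c => // k IH S c; rewrite ltnS => Sk c0 gS Sc.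
have [Ss|sS] := leqP #|S| s.
  apply: (le_trans (gS S _ _)) => //; rewrite ler_wpM2l//.
  by rewrite -[leLHS]addr0 lerD ?normle// divr_ge0 ?sumr_ge0// ltW.
have [T [TS Ts Tz]] := @top_subset n (fun i => `|z i ord0|) S s (ltnW sS).
have /card_gt0P[i0 i0T] : (0 < #|T|)%N by rewrite Ts.
have [t tT tmin] := @arg_minP _ _ _ i0 (mem T) (fun i => `|z i ord0|) i0T.
set c' := `|z t ord0|.
have sT : s%:R * c' <= \sum_(i in T) `|z i ord0|.
  by rewrite -Ts mulr_natl -sumr_const; apply: ler_sum => i /tmin.
have -> : \sum_(i in S) `|z i ord0| =
    \sum_(i in T) `|z i ord0| + \sum_(i in S :\: T) `|z i ord0|.
  by rewrite (big_setID T) /= (finset.setIidPr TS).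
have -> : g S = g (T :|: (S :\: T)) by rewrite finset.setDE finset.setUIr finset.setUCr finset.setIT (finset.setUidPr TS).
have TST : [disjoint T & S :\: T] by rewrite -finset.setI_eq0 finset.setIDA finset.setDIl finset.setDv finset.set0I.
apply: (le_trans (gU TST)).
apply: (@le_trans _ _ (K * (Num.sqrt s%:R * c) + K * (Num.sqrt s%:R * c' +
    (\sum_(i in S :\: T) `|z i ord0|) / Num.sqrt s%:R))).
  apply: lerD.
    apply: (le_trans (gS _ TS _)); first by rewrite Ts.
    by rewrite ler_wpM2l// normle// ?Ts// => i /(fintype.subsetP TS)/Sc.
  apply: IH.
  - rewrite -(cardsID T S) (finset.setIidPr TS) Ts in Sk.
    by rewrite (leq_trans _ Sk)// -addn1 addnC leq_add2r.
  - exact: normr_ge0.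
  - by move=> A AS; apply: gS; rewrite (fintype.subset_trans AS)// finset.subsetDl.
  - by move=> i iST; exact: Tz.
rewrite -mulrDr ler_wpM2l// lerD2l mulrDl lerD2r.
by rewrite {1}sqE mulrAC ler_pM2r ?invr_gt0.
Qed.

End blocks.

(** [T] holds the largest entries of [S], and its own l1 norm pays for the first block after it. As
    [T] is chosen before [g], one [T] serves two subadditive functions: the norm of a restriction
    and the cross term under [Phi]. *)
Lemma tail_blocks n s (z : 'cV[R]_n) (S : {set 'I_n}) : (0 < s)%N ->
  exists T : {set 'I_n}, [/\ T \subset S, (#|T| <= s)%N &
    forall (K : R) (g : {set 'I_n} -> R), 0 <= K ->
    (forall A B : {set 'I_n}, [disjoint A & B] -> g (A :|: B) <= g A + g B) ->
    (forall A : {set 'I_n}, A \subset S :\: T -> (#|A| <= s)%N -> g A <= K * norm2 (mask A z)) ->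
    g (S :\: T) <= K * ((\sum_(i in S) `|z i ord0|) / Num.sqrt s%:R)].
Proof.
move=> s0.
have sq_gt0 : 0 < Num.sqrt s%:R :> R by rewrite sqrtr_gt0 ltr0n.
have [Ss|sS] := leqP #|S| s.
  (* The remainder is empty, and the bound on small sets already gives [g] of the empty set at most
     0. *)
  exists S; split=> // K g K0 gU gA.
  apply: (le_trans (gA _ _ _)); rewrite ?finset.setDv ?cards0// mask0.
  have /eqP -> : norm2 (0 : 'cV[R]_n) == 0 by rewrite norm2_eq0.
  by rewrite mulr0 mulr_ge0// divr_ge0 ?sumr_ge0// ltW.
have [T [TS Ts Tz]] := @top_subset n (fun i => `|z i ord0|) S s (ltnW sS).
exists T; split; rewrite ?Ts// => K g K0 gU gA.
have /card_gt0P[i0 i0T] : (0 < #|T|)%N by rewrite Ts.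
have [t tT tmin] := @arg_minP _ _ _ i0 (mem T) (fun i => `|z i ord0|) i0T.
apply: (le_trans (@blocks_le n s z K g s0 K0 gU (S :\: T) `|z t ord0| _ gA _)) => //.
  by move=> i iST; exact: Tz.
have sT : s%:R * `|z t ord0| <= \sum_(i in T) `|z i ord0|.
  by rewrite -Ts mulr_natl -sumr_const; apply: ler_sum => i /tmin.
rewrite ler_wpM2l// [X in _ <= X / _](big_setID T)/= (finset.setIidPr TS) mulrDl lerD2r.
by rewrite ler_pdivlMr// mulrAC -expr2 sqr_sqrtr.
Qed.

(** * A quadratic inequality, and the lower bound on the cone *)

(** With [beta = b / A] and [gamma = Num.sqrt (c / A)], if [a] exceeded [beta + gamma], then both
    [a] and [a - beta] would exceed [gamma], against [a * (a - beta) <= gamma ^+ 2]. *)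
Lemma quadratic_le (A b c a : R) : 0 < A -> 0 <= b -> 0 <= c ->
  A * a ^+ 2 <= b * a + c -> a <= b / A + Num.sqrt (c / A).
Proof.
move=> A0 b0 c0 h.
have beta0 : 0 <= b / A by rewrite divr_ge0// ltW.
have gamma0 := sqrtr_ge0 (c / A).
have gammaE : Num.sqrt (c / A) ^+ 2 = c / A by rewrite sqr_sqrtr// divr_ge0// ltW.
have {}h : a ^+ 2 <= b / A * a + Num.sqrt (c / A) ^+ 2.
  rewrite gammaE -(ler_pM2l A0) (_ : A * (b / A * a + c / A) = b * a + c)//.
  by field; rewrite gt_eqF.
move: beta0 gamma0 h; set beta := b / A; set gamma := Num.sqrt _ => beta0 gamma0 h.
rewrite leNgt; apply/negP => ha.
have : gamma * gamma < a * (a - beta) by apply: ltr_pM => //; lra.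
by lra.
Qed.

Lemma cone_norm2_bounds n s (z : 'cV[R]_n) (T0 : {set 'I_n}) (sigma : R)
    m (Phi : 'M[R]_(m, n)) :
  (0 < s <= n)%N -> #|T0| = s -> 0 <= sigma ->
  \sum_(i in ~: T0) `|z i ord0| <= 3 * \sum_(i in T0) `|z i ord0| + 4 * sigma ->
  exists a : R, [/\ 0 <= a, \sum_(i in T0) `|z i ord0| <= Num.sqrt s%:R * a,
    norm2 z <= Num.sqrt 10 * a + 4 * sigma / Num.sqrt s%:R &
    A0bar s Phi * a ^+ 2 - A1bar s Phi * (sigma / Num.sqrt s%:R) * a
      <= norm2 (Phi *m z) ^+ 2].
Proof.
move=> /andP[s0 sn] T0s sigma0 hcone.
have [T1 [T1S T1s T1g]] := tail_blocks z (~: T0) s0.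
set q : R := Num.sqrt s%:R in T1g *.
have q0 : 0 < q by rewrite sqrtr_gt0 ltr0n.
pose U := T0 :|: T1; pose V := ~: T0 :\: T1.
have VE : V = ~: U by rewrite /V /U finset.setCU finset.setDE.
have UV : [disjoint U & V] by rewrite VE -finset.setI_eq0 finset.setICr.
have zE : z = mask U z + mask V z by rewrite -maskU// VE finset.setUCr maskT.
have U2s : (#|U| <= 2 * s)%N.
  by rewrite (leq_trans (leq_card_setU _ _))// T0s mul2n -addnn leq_add2l.
pose a := norm2 (mask U z); pose b := norm2 (mask V z).
have a0 : 0 <= a := norm2_ge0 _.
have T0a : \sum_(i in T0) `|z i ord0| <= q * a.
  apply: (le_trans (sum_abs_le z (eq_leq T0s))); rewrite ler_wpM2l ?sqrtr_ge0//.
  rewrite -(ler_pXn2r (n := 2)) ?nnegrE ?norm2_ge0// !norm2_mask_sqr.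
  rewrite [leRHS](big_setID T0)/= finset.setUK lerDl sumr_ge0// => i _.
  exact: sqr_ge0.
pose tau := 4 * sigma / q.
have tau0 : 0 <= tau by rewrite divr_ge0 ?mulr_ge0// ltW.
have hb : (\sum_(i in ~: T0) `|z i ord0|) / q <= 3 * a + tau.
  rewrite ler_pdivrMr// (le_trans hcone)//.
  have tauq : tau * q = 4 * sigma by rewrite divfK// gt_eqF.
  by rewrite [leRHS]mulrDl tauq lerD2r -mulrA (mulrC a) ler_wpM2l.
(* First use of the blocks: the norm is subadditive on disjoint supports, with [K = 1]. *)
have bE : b <= 3 * a + tau.
  apply: le_trans hb; rewrite -[leRHS]mul1r.
  apply: (T1g 1 (fun A => norm2 (mask A z))) => //; last by move=> *; rewrite mul1r.
  move=> A B AB; rewrite maskU// -(ler_pXn2r (n := 2)) ?nnegrE ?addr_ge0 ?norm2_ge0//.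
  rewrite norm2D_sqr (dotv_mask z AB) mulr0 addr0 sqrrD lerD2r lerDl.
  by rewrite mulrn_wge0// mulr_ge0// norm2_ge0.
pose D := rho_plus (3 * s) Phi - rho_minus (3 * s) Phi.
have D0 : 0 <= D.
  by rewrite subr_ge0 rho_minus_le_plus// ?muln_gt0// (leq_trans s0).
(* Second use of the blocks: [U] has at most [2 * s] indices and a block at most [s], whence the
   order [3 * s] in [D]. *)
have cross : - dotv (Phi *m mask U z) (Phi *m mask V z) <= 2^-1 * D * a * (3 * a + tau).
  have K0 : 0 <= 2^-1 * D * a by rewrite !mulr_ge0.
  apply: le_trans (ler_wpM2l K0 hb).
  apply: (T1g _ (fun A => - dotv (Phi *m mask U z) (Phi *m mask A z))) => //.
    by move=> A B AB; rewrite maskU// mulmxDr dotvDr opprD.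
  move=> A AV As; apply: dotv_mulmx_mask_ge.
    by rewrite disjoint_sym (fintype.disjointWl AV)// disjoint_sym.
  by rewrite (leq_trans (leq_card_setU _ _))// (mulnDl 2 1) mul1n leq_add.
exists a; split => //.
(* From [b <= 3 * a + tau], the squared norm is at most [10 * a ^+ 2 + 6 * a * tau + tau ^+ 2];
   since 3 is at most [Num.sqrt 10], this is at most the square of [Num.sqrt 10 * a + tau]. *)
- have r3 : 3 <= Num.sqrt 10 :> R.
    by rewrite -(ler_pXn2r (n := 2)) ?nnegrE// sqr_sqrtr//; lra.
  rewrite -/tau -(ler_pXn2r (n := 2)) ?nnegrE ?norm2_ge0//; last first.
    by rewrite addr_ge0// mulr_ge0// sqrtr_ge0.
  rewrite {1}zE norm2D_sqr (dotv_mask z UV) mulr0 addr0 -/a -/b.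
  have r10 : Num.sqrt 10 ^+ 2 = 10 :> R by rewrite sqr_sqrtr.
  have hb2 : b ^+ 2 <= (3 * a + tau) ^+ 2.
    by rewrite lerXn2r ?nnegrE ?norm2_ge0// addr_ge0// mulr_ge0.
  have : 3 * (a * tau) <= Num.sqrt 10 * (a * tau).
    by rewrite ler_wpM2r// mulr_ge0.
  move: (Num.sqrt 10) r10 => r r10; rewrite sqrrD exprMn r10; lra.
(* The term of [V] is dropped as nonnegative. Twice the cross term costs [D * a * (3 * a + tau)]:
   its first part turns [rho_minus (2 * s) Phi] into [A0bar], its second part is the [A1bar]
   term. *)
- rewrite {1}zE mulmxDr norm2D_sqr.
  have := rho_minus_le Phi z U2s; rewrite -/a => hU.
  have := sqr_ge0 (norm2 (Phi *m mask V z)).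
  rewrite /A0bar /A1bar -/D.
  have -> : 4 * D * (sigma / q) * a = D * a * tau by rewrite /tau; ring.
  move: cross; set X := dotv _ _; set Y := norm2 (_ *m mask V z) ^+ 2.
  move: hU; set W := norm2 _ ^+ 2 => hU; lra.
Qed.
End vectors.

(** * The maximum norm in terms of entries *)

Section matrix_norm.
Variables (R : realType) (m n : nat).

(** The sign of [c] matters for an empty matrix, whose norm is 0. *)
Lemma mx_norm_le_entries (A : 'M[R]_(m, n)) c : 0 <= c ->
  (`|A| <= c) <-> (forall i j, `|A i j| <= c).
Proof.
move=> c0; rewrite /Num.Def.normr/= mx_normrE; split.
  move=> h i j; apply: le_trans h.
  by apply: (le_bigmax _ (fun x : 'I_m * 'I_n => `|A x.1 x.2|) (i, j)).
by move=> h; apply/bigmax_leP; split=> // -[i j] _; exact: h.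
Qed.

End matrix_norm.

(** * Error bounds for a fixed noise vector *)

Section deterministic_bounds.
Variables (R : realType) (M N s : nat) (Phi : 'M[R]_(M, N)).
Variables (y : 'cV[R]_M) (Delta lambda : R) (xstar xhat : 'cV[R]_N).
Hypotheses (Delta_gt0 : 0 < Delta) (lambda_gt0 : 0 < lambda).
Hypothesis xstar_dist : `|Phi *m xstar - y| <= Delta / 2.
Hypothesis xhat_dist : `|Phi *m xhat - y| <= Delta / 2.
Hypothesis xhat_min :
  objective Phi y lambda Delta xhat <= objective Phi y lambda Delta xstar.
Hypothesis noise : `|Phi^T *m (Phi *m xstar - y)| <= lambda * Delta / 2.

Let h := xhat - xstar.

(** [Phi *m h] is the difference of two residuals with entries at most [Delta / 2]. *)
Lemma residual_error_le : norm2 (Phi *m h) ^+ 2 <= M%:R * Delta ^+ 2.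
Proof.
have D2 : 0 <= Delta / 2 by rewrite divr_ge0// ltW.
rewrite norm2_sqr -[M in leRHS]card_ord mulr_natl -sumr_const ler_sum// => i _.
have /mx_norm_le_entries-/(_ D2 i ord0) := xstar_dist.
have /mx_norm_le_entries-/(_ D2 i ord0) := xhat_dist.
have -> : Phi *m h = (Phi *m xhat - y) - (Phi *m xstar - y).
  by rewrite mulmxBr opprB addrA subrK.
move: (Phi *m xhat - y) (Phi *m xstar - y) => u v.
rewrite [in X in X ^+ 2]mxE [in X in (_ + X) ^+ 2]mxE.
rewrite !ler_norml => /andP[? ?] /andP[? ?].
rewrite -(real_normK (num_real (_ + _))) lerXn2r ?nnegrE//; first exact: ltW.
by rewrite ler_norml; apply/andP; split; lra.
Qed.

(** Twice the optimality inequality, with the cross term of the residual bounded below through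
    [noise]. Keeping the square on the left gives both the cone membership and the upper bound used
    for (a). *)
Lemma cone_condition (T0 : {set 'I_N}) :
  norm2 (Phi *m h) ^+ 2 <=
  lambda * Delta * (3 * \sum_(i in T0) `|h i ord0| -
    \sum_(i in ~: T0) `|h i ord0| + 4 * \sum_(i in ~: T0) `|xstar i ord0|).
Proof.
have lD0 : 0 < lambda * Delta by rewrite mulr_gt0.
pose e := Phi *m xstar - y.
have split1 (z : 'cV[R]_N) : norm1 z =
    \sum_(i in T0) `|z i ord0| + \sum_(i in ~: T0) `|z i ord0|.
  rewrite /norm1 (bigID (mem T0))/=; congr (_ + _).
  by apply: eq_bigl => i; rewrite inE.
have xhatE : Phi *m xhat - y = Phi *m h + e by rewrite mulmxBr addrA subrK.
(* Hölder's inequality between [h] and [Phi^T *m e]. *)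
have dot_ge : - (lambda * Delta / 2 * norm1 h) <= dotv (Phi *m h) e.
  rewrite dotv_mulmx lerNl -sumrN mulr_sumr ler_sum// => i _.
  apply: (le_trans (ler_norm _)); rewrite normrN normrM mulrC ler_wpM2r//.
  by have /mx_norm_le_entries := noise; apply; rewrite divr_ge0// ltW.
have norm1_le : norm1 xstar - norm1 xhat <= \sum_(i in T0) `|h i ord0| -
    \sum_(i in ~: T0) `|h i ord0| + 2 * \sum_(i in ~: T0) `|xstar i ord0|.
  have T0_le : \sum_(i in T0) `|xstar i ord0| - \sum_(i in T0) `|xhat i ord0|
      <= \sum_(i in T0) `|h i ord0|.
    rewrite -sumrB ler_sum// => i _; rewrite !mxE [leRHS]distrC.
    exact: lerB_dist.
  have T0c_le : \sum_(i in ~: T0) `|h i ord0| <=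
      \sum_(i in ~: T0) `|xstar i ord0| + \sum_(i in ~: T0) `|xhat i ord0|.
    by rewrite -big_split ler_sum// => i _; rewrite !mxE [leRHS]addrC ler_normB.
  rewrite !split1; lra.
have := xhat_min; rewrite /objective xhatE norm2D_sqr -/e => hmin.
have : lambda * Delta * (norm1 xstar - norm1 xhat) <= lambda * Delta *
   (\sum_(i in T0) `|h i ord0| - \sum_(i in ~: T0) `|h i ord0| +
    2 * \sum_(i in ~: T0) `|xstar i ord0|) by rewrite ler_pM2l.
move: hmin dot_ge; rewrite (split1 h); lra.
Qed.

Lemma error_bounds (T0 : {set 'I_N}) :
  (0 < s <= N)%N -> #|T0| = s -> 0 < A0bar s Phi ->
  bound_a Phi lambda Delta s xstar h T0 /\ bound_b Phi Delta s xstar h T0.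
Proof.
move=> sN T0s A0; rewrite /bound_a /bound_b norm1_subvec.
set sigma := \sum_(i in ~: T0) `|xstar i ord0|.
have sigma0 : 0 <= sigma by exact: sumr_ge0.
have lD0 : 0 < lambda * Delta by rewrite mulr_gt0.
have cone := cone_condition T0; rewrite -/sigma in cone.
have {}cone1 : \sum_(i in ~: T0) `|h i ord0| <=
    3 * \sum_(i in T0) `|h i ord0| + 4 * sigma.
  have : 0 <= lambda * Delta * (3 * \sum_(i in T0) `|h i ord0| -
    \sum_(i in ~: T0) `|h i ord0| + 4 * sigma).
    exact: le_trans (sqr_ge0 _) cone.
  by rewrite pmulr_rge0//; lra.
have [a [a0 T0a ha quad]] := cone_norm2_bounds Phi sN T0s sigma0 cone1.
set q : R := Num.sqrt s%:R in T0a ha quad *.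
have [s0 sleN] := andP sN.
have q0 : 0 < q by rewrite sqrtr_gt0 ltr0n.
have A1 : 0 <= A1bar s Phi.
  rewrite mulr_ge0// subr_ge0 rho_minus_le_plus ?muln_gt0//.
  exact: leq_trans sleN.
set A := A0bar s Phi in A0 quad *.
have r10 : Num.sqrt (10 : R) ^+ 2 = 10 by rewrite sqr_sqrtr.
have C2E (x : R) : Num.sqrt 10 * Num.sqrt (x / A) = C2bar s Phi * Num.sqrt x.
  have A0' : 0 <= 10 / A by rewrite divr_ge0// ltW.
  by rewrite -sqrtrM// -sqrtrM// mulrAC mulrA.
have C1E : C1bar s Phi / q * sigma =
    Num.sqrt 10 * (A1bar s Phi * (sigma / q) / A) + 4 * sigma / q.
  by rewrite /C1bar -/A; field; rewrite !gt_eqF.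
have b0 : 0 <= A1bar s Phi * (sigma / q) by rewrite mulr_ge0// divr_ge0// ltW.
split.
- have C2sq : C2bar s Phi ^+ 2 = 10 / A by rewrite sqr_sqrtr// divr_ge0// ltW.
  (* For (a) the negative l1 term off [T0] is discarded, and the l1 norm on [T0] is at most
     [q * a]. *)
  have {}quad : A * a ^+ 2 <= (A1bar s Phi * (sigma / q) + lambda * Delta * 3 * q) * a
      + 4 * (lambda * Delta * sigma).
    have : lambda * Delta * (3 * \sum_(i in T0) `|h i ord0| -
      \sum_(i in ~: T0) `|h i ord0| + 4 * sigma) <=
      lambda * Delta * (3 * (q * a) + 4 * sigma).
      rewrite ler_pM2l// lerD2r.
      have : 0 <= \sum_(i in ~: T0) `|h i ord0| by exact: sumr_ge0.
      lra.
    by move: quad cone; lra.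
  have := quadratic_le A0 _ _ quad.
  have c0 : 0 <= lambda * Delta * sigma by rewrite mulr_ge0// ltW.
  have l0 : 0 <= lambda * Delta * 3 * q by rewrite mulr_ge0 ?mulr_ge0 ?ltW.
  move=> /(_ (addr_ge0 b0 l0) (mulr_ge0 (ler0n _ 4) c0)).
  have -> : Num.sqrt (4 * (lambda * Delta * sigma) / A) =
      2 * Num.sqrt (lambda * Delta * sigma / A).
    rewrite -mulrA sqrtrM// (_ : 4 = 2 ^+ 2 :> R) ?sqrtr_sqr ?ger0_norm//; ring.
  move=> ha'; have {ha'} := ler_wpM2l (sqrtr_ge0 10) ha'.
  rewrite mulrDr [Num.sqrt 10 * (2 * _)]mulrCA C2E.
  have := sqrtr_ge0 (lambda * Delta * sigma).
  have C20 : 0 <= C2bar s Phi by exact: sqrtr_ge0.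
  move=> S0; have CS := mulr_ge0 C20 S0.
  rewrite C1E C2sq.
  (* The quadratic inequality yields the coefficient [3 * Num.sqrt 10] where (a) allows 20, and 2
     where (a) allows [5 / 2]; this crude bound suffices. *)
  have r3 : Num.sqrt (10 : R) <= 4.
    by rewrite -(ler_pXn2r (n := 2)) ?nnegrE ?sqrtr_ge0// r10; lra.
  have t0 : 0 <= lambda * Delta * q / A by rewrite divr_ge0 ?mulr_ge0 ?ltW.
  have := ler_wpM2r t0 r3.
  have -> : 2 * (10 / A) * q * lambda * Delta = 20 * (lambda * Delta * q / A) by ring.
  have -> : (A1bar s Phi * (sigma / q) + lambda * Delta * 3 * q) / A =
    A1bar s Phi * (sigma / q) / A + 3 * (lambda * Delta * q / A) by ring.
  move: CS ha t0.
  set X := A1bar _ _ * _ / A; set Y := lambda * Delta * q / A.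
  set W := 4 * sigma / q; set r := Num.sqrt 10.
  by move=> *; lra.
- have {}quad : A * a ^+ 2 <= A1bar s Phi * (sigma / q) * a + M%:R * Delta ^+ 2.
    by move: quad residual_error_le; lra.
  have := quadratic_le A0 b0 (mulr_ge0 (ler0n _ _) (sqr_ge0 _)) quad.
  move=> /(ler_wpM2l (sqrtr_ge0 10)); rewrite mulrDr C2E sqrtrM// sqrtr_sqr.
  rewrite gtr0_norm// mulrA C1E.
  by move: ha; lra.
Qed.

End deterministic_bounds.

Local Open Scope classical_set_scope.

(** * Expectation of a product of independent variables *)

Section independence.
Context d (T : measurableType d) (R : realType) (P : probability T R).

Lemma measurable_EFin_comp (X : {RV P >-> R}) (f : R -> R) (Z : T -> R) :
  measurable_fun setT f -> measurable_fun setT Z ->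
  measurable_fun setT (fun w => (f (X w) * Z w)%:E : \bar R).
Proof.
move=> mf mZ; apply/measurable_EFinP; apply: measurable_funM => //.
exact: measurableT_comp.
Qed.

Import HBNNSimple.

(** The identity passes from indicators to simple functions by linearity, and to nonnegative
    measurable functions by monotone convergence. [Z] stands for the product of the other
    factors. *)
Lemma integral_comp_mul (X : {RV P >-> R}) (Z : T -> R) (c : \bar R) :
  measurable_fun setT Z -> (forall w, 0 <= Z w) -> (0 <= c)%E ->
  (forall B : set R, measurable B ->
     (\int[P]_w (\1_B (X w) * Z w)%:E = c * \int[P]_w (\1_B (X w))%:E)%E) ->
  forall f : R -> R, measurable_fun setT f -> (forall x, 0 <= f x) ->
  (\int[P]_w (f (X w) * Z w)%:E = c * \int[P]_w (f (X w))%:E)%E.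
Proof.
move=> mZ Z0 c0 hB f mf f0.
have m1 (g : R -> R) : measurable_fun setT g ->
    measurable_fun setT (fun w => (g (X w))%:E : \bar R).
  by move=> mg; apply/measurable_EFinP; exact: measurableT_comp.
have simple (phi : {nnsfun R >-> R}) :
    (\int[P]_w (phi (X w) * Z w)%:E = c * \int[P]_w (phi (X w))%:E)%E.
  pose s := finmap.enum_fset (fset_set (range phi)).
  pose g (y : R) : R -> R := \1_(phi @^-1` [set y]).
  have mg y : measurable_fun setT (g y) by exact: measurable_indic.
  have g0 y x : 0 <= g y x by rewrite /g indicE.
  (* The values of [phi] are nonnegative, so the absolute value changes nothing; it makes every
     summand visibly nonnegative for the exchange with the integral. *)
  have phiE x : phi x = \sum_(y <- s) `|y| * g y x.
    rewrite {1}fimfunE fsbig_finite//=; apply: eq_big_seq => y.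
    rewrite in_fset_set// inE => -[z _ <-]; congr (_ * _).
    by rewrite ger0_norm// fun_ge0.
  transitivity (\sum_(y <- s) `|y|%:E * \int[P]_w (g y (X w) * Z w)%:E)%E.
    transitivity (\int[P]_w (\sum_(y <- s) `|y|%:E * (g y (X w) * Z w)%:E))%E.
      apply: eq_integral => w _; rewrite phiE mulr_suml -sumEFin.
      by apply: eq_bigr => y _; rewrite -EFinM mulrA.
    rewrite ge0_integral_sum//; last 2 first.
    - by move=> y; apply: measurable_funeM; exact: measurable_EFin_comp.
    - by move=> y w _; rewrite mule_ge0// lee_fin mulr_ge0.
    apply: eq_bigr => y _; rewrite ge0_integralZl_EFin//.
    - by move=> w _; rewrite lee_fin mulr_ge0.
    - exact: measurable_EFin_comp.
  have -> : (\int[P]_w (phi (X w))%:E =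
      \sum_(y <- s) `|y|%:E * \int[P]_w (g y (X w))%:E)%E.
    transitivity (\int[P]_w (\sum_(y <- s) `|y|%:E * (g y (X w))%:E))%E.
      apply: eq_integral => w _; rewrite phiE -sumEFin.
      by apply: eq_bigr => y _; rewrite -EFinM.
    rewrite ge0_integral_sum//; last 2 first.
    - by move=> y; apply: measurable_funeM; exact: m1.
    - by move=> y w _; rewrite mule_ge0// lee_fin.
    apply: eq_bigr => y _; rewrite ge0_integralZl_EFin//.
    - by move=> w _; rewrite lee_fin.
    - exact: m1.
  rewrite ge0_sume_distrr; last first.
    by move=> y _; rewrite mule_ge0// integral_ge0// => w _; rewrite lee_fin.
  by apply: eq_bigr => y _; rewrite hB// muleCA.
have mEf : measurable_fun setT (EFin \o f) by exact/measurable_EFinP.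
pose phi := nnsfun_approx measurableT mEf.
have phi_cvg x : EFin \o phi^~ x @ \oo --> (f x)%:E.
  by apply: (@cvg_nnsfun_approx _ _ _ _ measurableT _ mEf) => // y _; rewrite lee_fin.
have phi_nd x : nondecreasing_seq (phi^~ x).
  by move=> m n mn; have /lefP/(_ x) := nd_nnsfun_approx measurableT mEf mn.
have -> : (\int[P]_w (f (X w) * Z w)%:E =
    limn (fun n => \int[P]_w (phi n (X w) * Z w)%:E))%E.
  rewrite -monotone_convergence//.
  - apply: eq_integral => w _; apply/esym/cvg_lim => //.
    under eq_fun do rewrite EFinM.
    by rewrite EFinM; apply: cvgeZr => //; exact: phi_cvg.
  - by move=> n; exact: measurable_EFin_comp.
  - by move=> n w _; rewrite lee_fin mulr_ge0// fun_ge0.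
  - by move=> w _ m n mn; rewrite lee_fin ler_wpM2r//; exact: phi_nd.
have phiX_nd m n : (m <= n)%N ->
    (\int[P]_w (phi m (X w))%:E <= \int[P]_w (phi n (X w))%:E)%E.
  move=> mn; apply: ge0_le_integral => //.
  - by move=> w _; rewrite lee_fin fun_ge0.
  - exact: m1.
  - exact: m1.
  - by move=> w _; rewrite lee_fin; exact: phi_nd.
have -> : (\int[P]_w (f (X w))%:E = limn (fun n => \int[P]_w (phi n (X w))%:E))%E.
  rewrite -monotone_convergence//.
  - by apply: eq_integral => w _; apply/esym/cvg_lim => //; exact: phi_cvg.
  - by move=> n; exact: m1.
  - by move=> n w _; rewrite lee_fin fun_ge0.
  - by move=> w _ m n mn; rewrite lee_fin; exact: phi_nd.
under eq_fun do rewrite simple.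
set u := (fun n => \int[P]_w (phi n (X w))%:E)%E.
have cvg_u : cvgn u by apply: ereal_nondecreasing_is_cvgn => m n; exact: phiX_nd.
have u_le n : (u n <= limn u)%E.
  by apply: lime_ge => //; exists n => // m /= nm; exact: phiX_nd.
(* [c] may be infinite, and multiplication is not continuous at infinity times 0; in that case every
   [u n] is 0. *)
have [u0|u_neq0] := eqVneq (limn u) 0%E.
  have uE n : u n = 0%E.
    apply/eqP; rewrite eq_le -u0 u_le u0 integral_ge0// => w _.
    by rewrite lee_fin fun_ge0.
  by rewrite u0 mule0; under eq_fun do rewrite -/(u _) uE mule0; rewrite lim_cst.
apply/cvg_lim => //; have [c_fin|c_inf] := boolP (c \is a fin_num).
  exact: cvgeZl.
exact: (cvgeM (mule_def_infty_neq0 c_inf u_neq0) (cvg_cst c) cvg_u).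
Qed.

(* Induction on the number of [f i] that are not indicator functions; the
   definition of independence is the case where all of them are. *)
Lemma independent_prod_expectation (I : finType) (X : I -> {RV P >-> R}) :
  mutually_independent X ->
  forall f : I -> R -> R, (forall i, measurable_fun setT (f i)) ->
  (forall i x, 0 <= f i x) ->
  (\int[P]_w (\prod_i f i (X i w))%:E = \prod_i \int[P]_w (f i (X i w))%:E)%E.
Proof.
move=> indep.
suff step (s : seq I) (f : I -> R -> R) : (forall i, measurable_fun setT (f i)) ->
    (forall i x, 0 <= f i x) ->
    (forall i, i \notin s -> exists2 B : set R, measurable B & f i = \1_B) ->
    (\int[P]_w (\prod_i f i (X i w))%:E = \prod_i \int[P]_w (f i (X i w))%:E)%E.
  move=> f mf f0; apply: (step (enum I)) => // i.
  by rewrite mem_enum.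
elim: s f => [|j s IH] f mf f0 fB.
  have /choice[B BP] : forall i, exists B : set R, measurable B /\ f i = \1_B.
    by move=> i; have [B mB ->] := fB i isT; exists B.
  have mB i : measurable (B i) by have [] := BP i.
  have fE i : f i = \1_(B i) by have [] := BP i.
  have mXB i : measurable (X i @^-1` B i).
    by rewrite -[X in measurable X]setTI; exact: measurable_funPT.
  have -> : (\int[P]_w (\prod_i f i (X i w))%:E =
      P (\bigcap_(i in [set` [set: I]%SET]) (X i @^-1` B i)))%E.
    rewrite -[in RHS](setIT (\bigcap_(i in _) _)) -integral_indic//; last first.
      by apply: fin_bigcap_measurable => //; exact: finite_finset.
    apply: eq_integral => w _; congr EFin.
    have [wB|wB] := pselect (forall i, B i (X i w)).
      rewrite indicE mem_set; last by move=> i _; exact: wB.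
      by rewrite big1// => i _; rewrite fE indicE mem_set.
    have [i Bi] : exists i, ~ B i (X i w) by apply/existsNP.
    rewrite indicE memNset; last by move=> /(_ i); rewrite /= finset.in_setT => /(_ isT).
    by rewrite (bigD1 i)//= fE indicE memNset// mul0r.
  rewrite indep//; apply: eq_big => [i|i _]; first by rewrite finset.in_setT.
  rewrite -[in LHS](setIT (X i @^-1` B i)) -integral_indic//.
  by apply: eq_integral => w _; rewrite fE.
pose Z w := \prod_(i | i != j) f i (X i w).
have mXf i : measurable_fun setT (f i \o X i) by exact: measurableT_comp.
have mZ : measurable_fun setT Z.
  rewrite /Z; under eq_fun do rewrite -big_filter.
  by apply: measurable_prod => i _; exact: mXf.
have Z0 w : 0 <= Z w by apply: prodr_ge0.
pose c := (\prod_(i | i != j) \int[P]_w (f i (X i w))%:E)%E.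
have c0 : (0 <= c)%E.
  by apply: prode_ge0 => i _; apply: integral_ge0 => w _; rewrite lee_fin.
transitivity (\int[P]_w (f j (X j w) * Z w)%:E)%E.
  by apply: eq_integral => w _; rewrite (bigD1 j).
rewrite [RHS](bigD1 j)//= muleC.
apply: integral_comp_mul => // B mB.
(* With an indicator in place of factor [j], the induction hypothesis is the identity that
   [integral_comp_mul] asks for. *)
pose f' i := if i == j then \1_B else f i.
have f'j : f' j = \1_B by rewrite /f' eqxx.
have f'N i : i != j -> f' i = f i by rewrite /f' => /negbTE->.
have := IH f'; rewrite (bigD1 j)//= f'j muleC.
rewrite (eq_bigr (fun i => \int[P]_w (f i (X i w))%:E)%E); last first.
  by move=> i ij; rewrite f'N.
move=> <-.
- apply: eq_integral => w _; rewrite (bigD1 j)//= f'j; congr (_ * _)%:E.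
  by apply: eq_bigr => i ij; rewrite f'N.
- by move=> i; rewrite /f'; case: ifP => // _; exact: measurable_indic.
- by move=> i x; rewrite /f'; case: ifP => // _; rewrite indicE.
- move=> i iS; rewrite /f'; case: ifPn => [_|ij]; first by exists B.
  by apply: fB; rewrite inE negb_or ij.
Qed.

End independence.

(** * Exponential inequalities *)

Section exponential_bounds.
Variable R : realType.

Lemma double_fact_ge k : (2 ^ k * k`! <= (k.*2)`!)%N.
Proof.
elim: k => // k IH; rewrite doubleS !factS expnS.
by rewrite mulnACA mul2n doubleS leq_mul// (leq_trans IH)// leq_pmull.
Qed.

(* Termwise comparison of the even power series, by [2 ^ k * k! <= (2 k)!]. *)
Lemma expR_cosh_le (x : R) : expR x + expR (- x) <= 2 * expR (x ^+ 2 / 2).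
Proof.
pose a i : R := exp_coeff x i + exp_coeff (- x) i.
pose b i : R := exp_coeff (x ^+ 2 / 2) i.
have aE i : a i = (x ^+ i + (- x) ^+ i) / i`!%:R.
  by rewrite /a /exp_coeff /= mulrDl.
have a_odd k : a k.*2.+1 = 0.
  by rewrite aE exprNn -signr_odd /= odd_double expr1 mulN1r subrr mul0r.
have a_even k : a k.*2 <= 2 * b k.
  rewrite aE exprNn -signr_odd odd_double expr0 mul1r -mulr2n -[X in X / _]mulr_natl -mulrA.
  rewrite ler_wpM2l// /b /exp_coeff /= exprMn -exprM mul2n -mulrA ler_wpM2l//.
    by rewrite -mul2n exprM exprn_ge0// sqr_ge0.
  rewrite exprVn -invfM lef_pV2 ?posrE ?mulr_gt0 ?exprn_gt0 ?ltr0n ?fact_gt0//.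
  by rewrite -natrX -natrM ler_nat double_fact_ge.
have a_ge0 i : 0 <= a i.
  rewrite -(odd_double_half i); case: (odd i); first by rewrite add1n a_odd.
  rewrite add0n aE exprNn -signr_odd odd_double expr0 mul1r divr_ge0//.
  by rewrite addr_ge0// -mul2n exprM exprn_ge0// sqr_ge0.
have sum_double n : \sum_(0 <= i < n.*2) a i <= 2 * \sum_(0 <= i < n) b i.
  elim: n => [|n IH]; first by rewrite !big_geq// mulr0.
  by rewrite doubleS !big_nat_recr//= a_odd addr0 mulrDr lerD.
have b_le n : \sum_(0 <= i < n) b i <= expR (x ^+ 2 / 2).
  apply: (nondecreasing_cvgn_le _ (is_cvg_series_exp_coeff _)).
  apply: nondecreasing_series => i _ _; rewrite exp_coeff_ge0// divr_ge0//.
  exact: sqr_ge0.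
have cvga : series a @ \oo --> expR x + expR (- x).
  rewrite (_ : series a = series (exp_coeff x) \+ series (exp_coeff (- x))).
    by apply: cvgD; exact: is_cvg_series_exp_coeff.
  by apply/funext => n; rewrite /series /= -big_split.
rewrite -(cvg_lim _ cvga)//; apply: limr_le; first by apply/cvg_ex; eexists; exact: cvga.
(* Adding nonnegative terms up to an even index lets the terms pair up as in [sum_double]. *)
apply: nearW => n; apply: (@le_trans _ _ (\sum_(0 <= i < n.*2) a i)).
  rewrite [leRHS](@big_cat_nat _ _ _ n)//= -?addnn ?leq_addr//.
  by rewrite lerDl sumr_ge0.
by rewrite (le_trans (sum_double n))// ler_pM2l.
Qed.

(** The bound is affine in [y], so a centered variable leaves only its constant term. *)
Lemma expR_le_chord (r c y : R) : 0 < c -> `|y| <= c ->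
  expR (r * y) <= (expR (r * c) + expR (- (r * c))) / 2
    + (expR (r * c) - expR (- (r * c))) / (2 * c) * y.
Proof.
move=> c0; rewrite ler_norml => /andP[ly uy].
(* Convexity: average the tangent at [r * y] over the endpoints [+-(r * c)]. *)
have tangent z : expR (r * y) * (1 + (z - r * y)) <= expR z.
  rewrite -[z in leRHS](subrK (r * y)) expRD mulrC ler_pM2r ?expR_gt0//.
  exact: expR_ge1Dx.
have h1 : (c + y) * (expR (r * y) * (1 + (r * c - r * y))) <= (c + y) * expR (r * c).
  by rewrite ler_wpM2l//; lra.
have h2 : (c - y) * (expR (r * y) * (1 + (- (r * c) - r * y))) <= (c - y) * expR (- (r * c)).
  by rewrite ler_wpM2l//; lra.
rewrite -(ler_pM2l (mulr_gt0 (ltr0n R 2) c0)).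
set p := expR (r * c) in h1 *; set q := expR (- _) in h2 *.
have -> : 2 * c * ((p + q) / 2 + (p - q) / (2 * c) * y) = (c + y) * p + (c - y) * q.
  by field; rewrite gt_eqF.
by move: h1 h2; set e := expR _; lra.
Qed.

End exponential_bounds.

(** * Hoeffding's inequality *)

Section hoeffding.
Context d (T : measurableType d) (R : realType) (P : probability T R).

(** Hoeffding's lemma: integrating the chord bound leaves the hyperbolic cosine of [r * c], which
    [expR_cosh_le] controls. *)
Lemma mgf_centered_le (X : {RV P >-> R}) (c r : R) : 0 < c ->
  {ae P, forall w, `|X w| <= c} -> ('E_P[X] = 0)%E ->
  (\int[P]_w (expR (r * X w))%:E <= (expR (r ^+ 2 * c ^+ 2 / 2))%:E)%E.
Proof.
move=> c0 Xc EX.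
(* Truncation makes the chord bound hold everywhere, and changes [X] only on a
   null set. *)
pose Y w := Num.max (- c) (Num.min (X w) c).
have mX : measurable_fun setT (X : T -> R) by [].
have mY : measurable_fun setT Y.
  by apply: measurable_maxr => //; exact: measurable_minr.
have Yc w : `|Y w| <= c.
  by rewrite ler_norml /Y le_max lexx/= ge_max ge_min lexx orbT andbT; lra.
have XY w : `|X w| <= c -> Y w = X w.
  by rewrite ler_norml /Y => /andP[? ?]; rewrite min_l// max_r.
have mexp (Z : T -> R) : measurable_fun setT Z ->
    measurable_fun setT (fun w => (expR (r * Z w))%:E).
  move=> mZ; apply/measurable_EFinP; apply: measurableT_comp => //.
  exact: measurable_funM.
have -> : (\int[P]_w (expR (r * X w))%:E = \int[P]_w (expR (r * Y w))%:E)%E.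
  apply: ge0_ae_eq_integral => //.
  - exact: mexp.
  - exact: mexp.
  - by apply: filterS Xc => w Xcw _; rewrite XY.
have EY : (\int[P]_w (Y w)%:E = 0)%E.
  rewrite -EX expectation_def; apply: ae_eq_integral => //.
  - exact/measurable_EFinP.
  - exact/measurable_EFinP.
  - by apply: filterS Xc => w Xcw _; rewrite XY.
have iY : P.-integrable setT (EFin \o Y).
  apply: measurable_bounded_integrable => //.
    by rewrite (le_lt_trans (probability_le1 _ _))// ltry.
  exists c; split; first exact: num_real.
  by move=> x cx w _; exact: le_trans (ltW cx).
pose al := (expR (r * c) + expR (- (r * c))) / 2.
pose be := (expR (r * c) - expR (- (r * c))) / (2 * c).
apply: (@le_trans _ _ (\int[P]_w (al + be * Y w)%:E)%E).
  apply: ge0_le_integral => //.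
  - exact: mexp.
  - apply/measurable_EFinP; apply: measurable_funD => //.
    exact: measurable_funM.
  - by move=> w _; rewrite lee_fin expR_le_chord.
have ial : P.-integrable setT (EFin \o cst al) by exact: finite_measure_integrable_cst.
have ibe : P.-integrable setT (fun w => be%:E * (Y w)%:E)%E by exact: integrableZl.
have -> : (\int[P]_w (al + be * Y w)%:E = al%:E)%E.
  under eq_integral do rewrite EFinD EFinM.
  rewrite (integralD _ ial ibe)// integralZl//= EY mule0 adde0.
  by rewrite integral_cst//= probability_setT mule1.
rewrite lee_fin /al ler_pdivrMr// [leRHS]mulrC -exprMn.
exact: expR_cosh_le.
Qed.

(** Chernoff's bound, with the moment generating function factored by independence. A bound [V] in
    place of the sum of squares gives one estimate for all columns and stays positive for a zero
    column. *)
Lemma hoeffding_tail (I : finType) (X : I -> {RV P >-> R}) (a : I -> R) (c V t : R) :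
  mutually_independent X -> 0 < c -> 0 < V -> 0 < t ->
  (forall i, {ae P, forall w, `|X i w| <= c}) ->
  (forall i, 'E_P[X i] = 0)%E -> \sum_i a i ^+ 2 <= V ->
  (P [set w | (t <= \sum_i a i * X i w)%R] <= (expR (- (t ^+ 2 / (2 * c ^+ 2 * V))))%:E)%E.
Proof.
move=> indep c0 V0 t0 Xc EX aV.
have mS : measurable_fun setT (fun w => \sum_i a i * X i w).
  by apply: measurable_sum => i; exact: measurable_funM.
pose S : {RV P >-> R} := mfun_Sub (mem_set mS).
(* Minimizer of the exponent [r ^+ 2 * c ^+ 2 * V / 2 - r * t]. *)
pose r := t / (c ^+ 2 * V).
have cV0 : 0 < c ^+ 2 * V by rewrite mulr_gt0// exprn_gt0.
have r0 : 0 < r by rewrite divr_gt0.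
apply: (le_trans (chernoff S t r0)).
have -> : ('M_P S r = \int[P]_w (\prod_i expR (r * a i * X i w))%:E)%E.
  rewrite /mmt_gen_fun unlock; apply: eq_integral => w _ /=.
  rewrite -expR_sum mulr_suml; congr (expR _)%:E.
  by apply: eq_bigr => i _; rewrite mulrC mulrA.
rewrite (independent_prod_expectation indep (f := fun i x => expR (r * a i * x))); last 2 first.
- by move=> i; apply: measurableT_comp => //; exact: measurable_funM.
- by move=> i x; exact: expR_ge0.
have prod_le : (\prod_i \int[P]_w (expR (r * a i * X i w))%:E <=
    \prod_i (expR ((r * a i) ^+ 2 * c ^+ 2 / 2))%:E)%E.
  (* Nonnegativity is carried along, since multiplying inequalities needs it. *)
  have : (0 <= \prod_i \int[P]_w (expR (r * a i * X i w))%:E <=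
    \prod_i (expR ((r * a i) ^+ 2 * c ^+ 2 / 2))%:E)%E; last by case/andP.
  elim/big_ind2 : _ => [|x1 x2 y1 y2 /andP[x0 xy] /andP[y0 xy']|i _].
  - by rewrite lexx lee01.
  - by rewrite mule_ge0// lee_pmul.
  - apply/andP; split; last exact: mgf_centered_le.
    by apply: integral_ge0 => w _; rewrite lee_fin expR_ge0.
rewrite -[leRHS]mul1e.
apply: (@le_trans _ _ (((\prod_i expR ((r * a i) ^+ 2 * c ^+ 2 / 2))%R)%:E * (expR (- (r * t)))%:E)%E).
  by rewrite lee_wpmul2r ?lee_fin ?expR_ge0// -prodEFin.
rewrite mul1e -EFinM lee_fin -expR_sum -expRD ler_expR.
have -> : \sum_i (r * a i) ^+ 2 * c ^+ 2 / 2 = r ^+ 2 * c ^+ 2 / 2 * \sum_i a i ^+ 2.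
  by rewrite mulr_sumr; apply: eq_bigr => i _; ring.
have h : r ^+ 2 * c ^+ 2 / 2 * \sum_i a i ^+ 2 <= r ^+ 2 * c ^+ 2 / 2 * V.
  by rewrite ler_wpM2l// divr_ge0// mulr_ge0// sqr_ge0.
have -> : t ^+ 2 / (2 * c ^+ 2 * V) = r * t - r ^+ 2 * c ^+ 2 / 2 * V.
  by rewrite /r; field; rewrite !gt_eqF.
lra.
Qed.

End hoeffding.

(** * Union bound over the columns *)

Lemma noise_correlation_event d (Omega : measurableType d) (R : realType)
    (P : probability Omega R) (M N : nat) (Phi : 'M[R]_(M, N))
    (e : 'I_M -> {RV P >-> R}) (Delta lambda p : R) :
  0 < Delta -> 0 < lambda -> mutually_independent e ->
  (forall j, 'E_P[e j] = 0)%E ->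
  (forall j, {ae P, forall w, `|e j w| <= Delta / 2}) -> 0 < p ->
  lambda = Num.sqrt (2 * ln (2 * N%:R / p)) * fmax Phi ->
  exists bad : set Omega, [/\ measurable bad, (P bad <= p%:E)%E &
    forall w, ~ bad w -> forall i : 'I_N,
      `|\sum_j Phi j i * e j w| <= lambda * Delta / 2].
Proof.
move=> D0 l0 indep Ee ec p0 lE.
case: N Phi lE => [|N] Phi lE.
  by exists set0; rewrite measure0 lee_fin ltW//; split=> // w _ [].
have f_ge0 : 0 <= fmax Phi by rewrite /fmax bigmax_ge_id.
(* Positivity of both factors of [lambda] is read off from [0 < lambda]. *)
have f0 : 0 < fmax Phi.
  by rewrite lt_neqAle f_ge0 andbT eq_sym; apply: contraTneq l0 => f0;
    rewrite lE f0 mulr0 ltxx.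
have L0 : 0 < 2 * ln (2 * N.+1%:R / p).
  rewrite -sqrtr_gt0 lt_neqAle sqrtr_ge0 andbT eq_sym.
  by apply: contraTneq l0 => s0; rewrite lE s0 mul0r ltxx.
have x0 : 0 < 2 * N.+1%:R / p by rewrite divr_gt0// mulr_gt0// ltr0n.
pose t := lambda * (Delta / 2).
have c0 : 0 < Delta / 2 by rewrite divr_gt0.
have tail (a : 'I_M -> R) : \sum_j a j ^+ 2 <= fmax Phi ^+ 2 ->
    (P [set w | (t <= \sum_j a j * e j w)%R] <= (p / (2 * N.+1%:R))%:E)%E.
  move=> aV; have V0 : 0 < fmax Phi ^+ 2 by rewrite exprn_gt0.
  have t0 : 0 < t by rewrite mulr_gt0.
  apply: (le_trans (hoeffding_tail indep c0 V0 t0 ec Ee aV)).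
  (* The choice of [lambda] makes the exponent exactly this logarithm, so each of the two tails per
     column gets an equal share of [p]. *)
  rewrite (_ : t ^+ 2 / _ = ln (2 * N.+1%:R / p)).
    by rewrite expRN lnK ?posrE// invf_div.
  rewrite /t lE !exprMn sqr_sqrtr ?ltW//.
  by field; rewrite !gt_eqF.
pose B a := [set w | t <= \sum_j a j * e j w].
have mB a : measurable (B a).
  rewrite -[B a]setTI; apply: measurable_fun_le => //.
  by apply: measurable_sum => j; exact: measurable_funM.
have col_le i : \sum_j Phi j i ^+ 2 <= fmax Phi ^+ 2.
  have -> : \sum_j Phi j i ^+ 2 = norm2 (col i Phi) ^+ 2.
    by rewrite norm2_sqr; apply: eq_bigr => j _; rewrite mxE.
  rewrite lerXn2r ?nnegrE ?norm2_ge0//.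
  exact: (le_bigmax _ (fun i => norm2 (col i Phi))).
pose C i := B (Phi ^~ i) `|` B (fun j => - Phi j i).
have mC i : measurable (C i) by exact: measurableU.
have PC i : (P (C i) <= (p / N.+1%:R)%:E)%E.
  apply: (le_trans (measureU2 _ (mB _) (mB _))).
  apply: (le_trans (leeD (tail _ (col_le i)) (tail (fun j => - Phi j i) _))).
    by under eq_bigr do rewrite sqrrN; exact: col_le.
  rewrite -EFinD lee_fin le_eqVlt; apply/orP; left; apply/eqP.
  have : N.+1%:R != 0 :> R by rewrite pnatr_eq0.
  by move: (N.+1%:R) => n n0; field.
have PU (s : seq 'I_N.+1) :
    (P (\big[setU/set0]_(i <- s) C i) <= \sum_(i <- s) (p / N.+1%:R)%:E)%E.
  elim: s => [|i s IH]; first by rewrite !big_nil measure0.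
  have mU : measurable (\big[setU/set0]_(i <- s) C i) by exact: bigsetU_measurable.
  rewrite !big_cons; apply: (le_trans (measureU2 _ (mC i) mU)).
  exact: leeD (PC i) IH.
exists (\big[setU/set0]_i C i); split.
- exact: bigsetU_measurable.
- rewrite (le_trans (PU _))// sumEFin lee_fin sumr_const card_ord.
  by rewrite -[leLHS]mulr_natr divfK// pnatr_eq0.
- move=> w bad i.
  have [Bp Bm] : ~ B (Phi ^~ i) w /\ ~ B (fun j => - Phi j i) w.
    by apply/not_orP => Cw; apply: bad; rewrite (bigD1 i)//=; left.
  move: Bp Bm => /negP; rewrite -ltNge => Bp /negP; rewrite -ltNge => Bm.
  rewrite ler_norml; apply/andP; split.
    rewrite lerNl -sumrN -mulrA (eq_bigr (fun j => - Phi j i * e j w)).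
      exact: ltW.
    by move=> j _; rewrite mulNr.
  by rewrite -mulrA; exact: ltW.
Qed.

Local Open Scope ring_scope.

(** * Error bounds for fixed and for random quantization errors *)

Theorem theorem1 (R : realType) (M Mp Mm N B s : nat) (Delta lambda : R)
    (Phi : 'M[R]_(M, N)) (Phip : 'M[R]_(Mp, N)) (Phim : 'M[R]_(Mm, N))
    (xstar : 'cV[R]_N) (G := saturation_level B Delta)
    (hB : (1 <= B)%N) (hDelta : 0 < Delta) (hlambda : 0 < lambda)
    (hs : (1 <= s <= N)%N) :
  (forall (y : 'cV[R]_M) (xhat : 'cV[R]_N),
     feasible Phi Phip Phim y Delta G xstar ->
     is_solution Phi Phip Phim y lambda Delta G xhat ->
     `|Phi^T *m (Phi *m xstar - y)| <= lambda * Delta / 2 ->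
     forall T0 : {set 'I_N}, #|T0| = s ->
       0 < A0bar s Phi ->
       bound_a Phi lambda Delta s xstar (xhat - xstar) T0 /\
       bound_b Phi Delta s xstar (xhat - xstar) T0)
  /\
  (forall (d : measure_display) (Omega : measurableType d)
     (P : probability Omega R) (y : Omega -> 'cV[R]_M)
     (xhat : Omega -> 'cV[R]_N) (e : 'I_M -> {RV P >-> R}) (p : R),
     (forall i w, e i w = (Phi *m xstar - y w) i ord0) ->
     {ae P, forall w, feasible Phi Phip Phim (y w) Delta G xstar} ->
     {ae P, forall w,
        is_solution Phi Phip Phim (y w) lambda Delta G (xhat w)} ->
     mutually_independent e ->
     (forall i, ('E_P[e i] = 0)%E) ->
     {ae P, forall w, forall i, `|e i w| <= Delta / 2} ->
     0 < A0bar s Phi ->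
     0 < p < 1 ->
     lambda = Num.sqrt (2 * ln (2 * N%:R / p)) * fmax Phi ->
     exists E : set Omega,
       [/\ measurable E,
           ((1 - p)%:E <= P E)%E
         & forall w, E w -> forall T0 : {set 'I_N}, #|T0| = s ->
             bound_a Phi lambda Delta s xstar (xhat w - xstar) T0 /\
             bound_b Phi Delta s xstar (xhat w - xstar) T0]).
Proof.
split.
  move=> y xhat feas [feash min] noise T0 T0s A0.
  have [dstar _ _] := feas; have [dhat _ _] := feash.
  by apply: (error_bounds (y := y)) => //; exact: min.
move=> d Omega P y xhat e p eE feas sol indep Ee ec A0 /andP[p0 p1] lE.
have ec' j : {ae P, forall w, `|e j w| <= Delta / 2}.
  by apply: filterS ec => w; exact.
have [bad [mbad Pbad badP]] :=
  noise_correlation_event hDelta hlambda indep Ee ec' p0 lE.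
(* [xhat] is an arbitrary function of [w], so the set where the bounds hold need not be measurable.
   The event is the complement of [bad] and of a measurable null set [Z]; it does not depend on
   [T0]. *)
have [Z [mZ PZ subZ]] : {ae P, forall w, feasible Phi Phip Phim (y w) Delta G xstar /\
    is_solution Phi Phip Phim (y w) lambda Delta G (xhat w)}.
  by apply: filterS2 feas sol => w; split.
have mbZ : measurable (bad `|` Z) by exact: measurableU.
exists (~` (bad `|` Z)); split.
- exact: measurableC.
- rewrite probability_setC// EFinB leeB//.
  by apply: (le_trans (measureU2 _ mbad mZ)); rewrite [X in (_ + X)%E]PZ adde0.
- move=> w /not_orP[nbad nZ] T0 T0s.
  have [[dstar feas1 feas2] [[dhat _ _] min]] :
      feasible Phi Phip Phim (y w) Delta G xstar /\
      is_solution Phi Phip Phim (y w) lambda Delta G (xhat w).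
    by apply: contrapT => h; apply: nZ; exact: subZ.
  apply: (error_bounds (y := y w)) => //; first exact: min.
  apply/mx_norm_le_entries; first by rewrite divr_ge0// mulr_ge0// ltW.
  move=> i j; rewrite ord1 mxE.
  rewrite (eq_bigr (fun j => Phi j i * e j w)); first exact: badP.
  by move=> k _; rewrite eE mxE.
Qed.
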